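(* Let $U\subset\mathbb{R}^2=\mathbb{C}$ be open, $g:U\to\mathbb{C}$ holomorphic with $g'\neq 0$ everywhere, $c$ a nonzero real constant, and $h:U\to\mathbb{R}$ a smooth nowhere-vanishing function. Let $Y,\eta,S$ be as defined in the context, and suppose that $X=Y-\frac{2(h+c)}{S}\eta:U\to\mathbb{R}^3$ and $\eta:U\to\mathbb{R}^3$ are immersions. Then $X$ is an $H_2$-surface if and only if $\eta$ is a Laguerre minimal surface.
   Context: Setting. Identify $\mathbb{R}^2=\mathbb{C}$ and $\mathbb{R}^3=\mathbb{C}\times\mathbb{R}$. Given $g$, let $T=1+|g|^2$ and let $Y:U\to\mathbb{S}^2$, $Y=\frac1T(2g,\,2-T)=\frac{1}{1+|g|^2}(2g,1-|g|^2)$. The induced metric is $L_{ij}=\langle Y_{,i},Y_{,j}\rangle=\frac{4|g'|^2}{T^2}\delta_{ij}$. Given smooth $h:U\to\mathbb{R}$, let $$\eta=\nabla_L h+hY,\qquad \nabla_L h=\frac{T^2}{4|g'|^2}\,(h_{,1}Y_{,1}+h_{,2}Y_{,2}),\qquad S=\langle\eta,\eta\rangle=|\nabla_Lh|^2+h^2 .$$ The map $X=Y-\frac{2(h+c)}{S}\eta$ is oriented by the unit normal $N=Y-\frac{2h}{S}\eta$, and $\langle X,N\rangle\ne1$ everywhere. The surface $\eta$ has unit normal $Y$. Curvatures. For an immersed surface $X$ with unit normal $N$ and $\langle X,N\rangle\neq1$, let $\Psi=\langle X,N\rangle$, $R=\frac{1-|X|^2}{2(\Psi-1)}$ (the radius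 function), let $k_1,k_2$ be the principal curvatures (eigenvalues of $-dN$), $s_i=\frac{1+k_i}{1-k_iR}$, and $H_S=\frac12(s_1+s_2)$ (the spherical mean curvature). $X$ is an $H_2$-surface if $\Delta_\sigma\left[\frac{H_S}{\Psi-1}\right]=0$, where $\Delta_\sigma$ is the Laplacian of the metric $\sigma=I-2R\,II+R^2\,III$, with $I=\langle dX,dX\rangle$, $II=-\langle dN,dX\rangle$, $III=\langle dN,dN\rangle$. Laguerre minimal surface: an immersed surface in $\mathbb{R}^3$ with mean curvature $H$ and nowhere-zero Gaussian curvature $K$ is Laguerre minimal if $\Delta_{III}\left(\frac{H}{K}\right)=0$, where $\Delta_{III}$ is the Laplacian of its third fundamental form. *)

(* Defs.v *)
From HB Require Import structures.
From mathcomp Require Import all_boot all_order all_algebra.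
From mathcomp Require Import complex.
From mathcomp Require Import all_classical all_reals all_analysis.

Set Implicit Arguments.
Unset Strict Implicit.
Unset Printing Implicit Defensive.

Import Order.TTheory GRing.Theory Num.Theory.
Import numFieldNormedType.Exports.

Local Open Scope classical_set_scope.
Local Open Scope ring_scope.
Local Open Scope complex_scope.

Section Calculus.
Variable R : realType.
Implicit Types (U : set 'rV[R]_2) (p : 'rV[R]_2).

Definition partial (V : normedModType R) (i : 'I_2) (f : 'rV[R]_2 -> V) :
  'rV[R]_2 -> V := fun p => 'D_(delta_mx 0 i) f p.

(* [foldr (@partial V) f s] is the iterated partial derivative of f along the
   multi-index s; for open U this is the class C^oo(U, V). *)
Definition smooth_on (V : normedModType R) U (f : 'rV[R]_2 -> V) : Prop :=
  forall (s : seq 'I_2) p, U p ->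
    {for p, continuous (foldr (@partial V) f s)} /\
    forall i : 'I_2, derivable (foldr (@partial V) f s) p (delta_mx 0 i).

Definition dot n (u v : 'rV[R]_n) : R := \sum_(i < n) u 0 i * v 0 i.

(* Row i is the i-th partial derivative, so the differential of X at p sends the
   row vector v to v *m differential X p. *)
Definition differential (X : 'rV[R]_2 -> 'rV[R]_3) p : 'M[R]_(2, 3) :=
  \matrix_(i < 2) partial i X p.

Definition immersion_on U (X : 'rV[R]_2 -> 'rV[R]_3) : Prop :=
  smooth_on U X /\ forall p, U p -> row_free (differential X p).

Definition unit_normal_on U (X N : 'rV[R]_2 -> 'rV[R]_3) : Prop :=
  forall p, U p ->
    dot (N p) (N p) = 1 /\ forall i : 'I_2, dot (N p) (partial i X p) = 0.

(* The Laplace-Beltrami operator of the metric with Gram matrix G, that is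
   det(G)^(-1/2) d_i (det(G)^(1/2) G^(ij) d_j f). *)
Definition laplacian (G : 'rV[R]_2 -> 'M[R]_2) (f : 'rV[R]_2 -> R) p : R :=
  (Num.sqrt (\det (G p)))^-1 *
  \sum_(i < 2) partial i (fun q => Num.sqrt (\det (G q)) *
    \sum_(j < 2) invmx (G q) i j * partial j f q) p.

End Calculus.

Section Surfaces.
Variable R : realType.
Variables X N : 'rV[R]_2 -> 'rV[R]_3.
Implicit Types (U : set 'rV[R]_2) (p : 'rV[R]_2).

Definition fundI p : 'M[R]_2 := differential X p *m (differential X p)^T.
Definition fundII p : 'M[R]_2 := - (differential N p *m (differential X p)^T).
Definition fundIII p : 'M[R]_2 := differential N p *m (differential N p)^T.

(* When N is a unit normal of the immersion X, this is the matrix W with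
   - differential N p = W *m differential X p. *)
Definition shape_operator p : 'M[R]_2 := fundII p *m invmx (fundI p).

Definition mean_curvature p : R := \tr (shape_operator p) / 2.
Definition gauss_curvature p : R := \det (shape_operator p).

(* The two eigenvalues of the shape operator, with algebraic multiplicity. Their
   order is arbitrary, and is only used in symmetric expressions. *)
Definition principal_curvatures p : R * R :=
  xget (0, 0) [set k : R * R | char_poly (shape_operator p) =
                                 ('X - k.1%:P) * ('X - k.2%:P)].

Definition Psi p : R := dot (X p) (N p).

Definition radius p : R := (1 - dot (X p) (X p)) / (2 * (Psi p - 1)).

Definition spherical_curvature p (k : R) : R := (1 + k) / (1 - k * radius p).

Definition spherical_mean_curvature p : R :=
  (spherical_curvature p (principal_curvatures p).1 +
   spherical_curvature p (principal_curvatures p).2) / 2.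

Definition sigma_metric p : 'M[R]_2 :=
  fundI p - (2 * radius p) *: fundII p + radius p ^+ 2 *: fundIII p.

(* The conditions 1 - k_i * radius <> 0 say that the spherical curvatures are
   defined; equivalently, that sigma_metric is non-degenerate. *)
Definition H2_surface U : Prop :=
  [/\ immersion_on U X,
      unit_normal_on U X N,
      forall p, U p -> Psi p != 1,
      forall p, U p -> 1 - (principal_curvatures p).1 * radius p != 0 /\
                       1 - (principal_curvatures p).2 * radius p != 0 &
      forall p, U p ->
        laplacian sigma_metric
          (fun q => spherical_mean_curvature q / (Psi q - 1)) p = 0].

Definition Laguerre_minimal U : Prop :=
  [/\ immersion_on U X,
      unit_normal_on U X N,
      forall p, U p -> gauss_curvature p != 0 &
      forall p, U p ->
        laplacian fundIII
          (fun q => mean_curvature q / gauss_curvature q) p = 0].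

End Surfaces.

Section Construction.
Variable R : realType.
Variable g : R[i] -> R[i].
Implicit Types (U : set 'rV[R]_2) (p : 'rV[R]_2).

Definition to_C p : R[i] := p 0 0 +i* p 0 1.

Definition to_R3 (z : R[i]) (t : R) : 'rV[R]_3 :=
  \row_(j < 3) [:: complex.Re z; complex.Im z; t]`_j.

(* [`|z|] in R[i] is itself a complex number, hence this real-valued version. *)
Definition normsq (z : R[i]) : R := complex.Re z ^+ 2 + complex.Im z ^+ 2.

(* The scalar field being R[i], these are complex differentiability and the
   complex derivative. *)
Definition holomorphic_on U : Prop :=
  forall p, U p -> derivable (g : R[i]^o -> R[i]^o) (to_C p) 1.

Definition complex_derive (z : R[i]) : R[i] :=
  'D_1 (g : R[i]^o -> R[i]^o) z.

Definition T_of p : R := 1 + normsq (g (to_C p)).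

Definition Y_of p : 'rV[R]_3 :=
  (T_of p)^-1 *: to_R3 (2 * g (to_C p)) (2 - T_of p).

Variable h : 'rV[R]_2 -> R.

Definition grad_L p : 'rV[R]_3 :=
  (T_of p ^+ 2 / (4 * normsq (complex_derive (to_C p)))) *:
    \sum_(i < 2) partial i h p *: partial i Y_of p.

Definition eta_of p : 'rV[R]_3 := grad_L p + h p *: Y_of p.

Definition S_of p : R := dot (eta_of p) (eta_of p).

Variable c : R.

Definition X_of p : 'rV[R]_3 := Y_of p - (2 * (h p + c) / S_of p) *: eta_of p.

Definition N_of p : 'rV[R]_3 := Y_of p - (2 * h p / S_of p) *: eta_of p.

End Construction.

(* Main.v *)
Require Import Defs.
From HB Require Import structures.
From mathcomp Require Import all_boot all_order all_algebra.
From mathcomp Require Import complex.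
From mathcomp Require Import all_classical all_reals all_analysis.
From mathcomp Require Import ring lra.
Import Order.TTheory GRing.Theory Num.Theory.
Import numFieldNormedType.Exports.
Local Open Scope classical_set_scope.
Local Open Scope ring_scope.
Local Open Scope complex_scope.

(* Write lam for the conformal factor of Y, W_ij = <eta_i, Y_j>, and E_i for
   the image of Y_i under the reflection in the plane orthogonal to eta. Then
   d eta = W dY / lam, while
     dX = (1 - 2 (h + c) / (S lam) W) E   and   dN = (1 - 2 h / (S lam) W) E
   with E E^T = lam, and the radius function is R = - (h + c) / h. Hence
   III_eta = lam and sigma = (c / h)^2 lam are both conformal to the flat
   metric, H / K = - tr W / (2 lam) for eta, and
   H_S / (Psi - 1) = tr W / (2 c lam) for X: in dimension two both conditions
   say that tr W / lam is harmonic for the flat Laplacian. Reality of the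
   principal curvatures of X needs W to be symmetric, which comes from the
   symmetry of the second derivatives of h and Y. That Y is smooth is not read
   off from the holomorphy of g, but from Y = X + 2 (h + c) / S eta. *)

(** * Functions with iterated partial derivatives, and symmetry of second derivatives *)

Section PartialDerivatives.
Set Implicit Arguments.
Unset Strict Implicit.
Context {R : realType}.
Implicit Types (U : set 'rV[R]_2) (f g : 'rV[R]_2 -> R) (p : 'rV[R]_2).
Implicit Types (i j : 'I_2).

Lemma near_open {U p} {P : 'rV[R]_2 -> Prop} :
  open U -> U p -> (forall q, U q -> P q) -> \forall q \near p, P q.
Proof.
move=> oU Up HP; have : nbhs p U by exact: open_nbhs_nbhs.
by apply: filterS.
Qed.

Lemma eq_partial {V : normedModType R} {U p} {f g : 'rV[R]_2 -> V} i :
  open U -> U p -> (forall q, U q -> f q = g q) -> partial i f p = partial i g p.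
Proof. by move=> oU Up fg; apply: near_eq_derive; exact: near_open fg. Qed.

Lemma derivable_entry {m n} {X : 'rV[R]_2 -> 'M[R]_(m, n)} {p v} k l :
  derivable X p v -> derivable (fun q => X q k l) p v.
Proof. by move/derivable_mxP. Qed.

Lemma partial_entry {m n} {X : 'rV[R]_2 -> 'M[R]_(m, n)} {p} i k l :
  derivable X p (delta_mx 0 i) -> partial i X p k l = partial i (fun q => X q k l) p.
Proof. by move=> dX; rewrite /partial derive_mx// mxE. Qed.

(** Continuity is listed separately because the existence of partial derivatives does not imply
    it. *)
Definition partially_derivable U f :=
  forall p, U p -> {for p, continuous f} /\ forall i, derivable f p (delta_mx 0 i).

(* The derivatives of order k still have partial derivatives here, so this is
   slightly stronger than the usual class C^k. *)
Fixpoint Ck (k : nat) U f : Prop :=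
  partially_derivable U f /\
  if k is k'.+1 then forall i, Ck k' U (partial i f) else True.

Lemma Ck_partially_derivable {k U f} : Ck k U f -> partially_derivable U f.
Proof. by case: k => [|k] []. Qed.

Lemma Ck_derivable {k U f p} i : Ck k U f -> U p -> derivable f p (delta_mx 0 i).
Proof. by move=> /Ck_partially_derivable Hf /Hf[]. Qed.

Lemma Ck_partial {k U f} i : Ck k.+1 U f -> Ck k U (partial i f).
Proof. by case=> _; apply. Qed.

Lemma CkW {k U f} : Ck k.+1 U f -> Ck k U f.
Proof.
elim: k f => [|k IH] f [Hf Hp]; first by split.
by split=> // i; apply: IH.
Qed.

Lemma Ck_subset {k V U f} : V `<=` U -> Ck k U f -> Ck k V f.
Proof.
move=> VU; have HV h : partially_derivable U h -> partially_derivable V h.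
  by move=> Hh p /VU; exact: Hh.
elim: k f => [|k IH] f [/HV Hf Pf]; split=> // l.
exact: (IH _ (Pf l)).
Qed.

Section OpenDomain.
Context {U : set 'rV[R]_2} (U_open : open U).

Lemma eq_partially_derivable f g : (forall p, U p -> f p = g p) ->
  partially_derivable U f -> partially_derivable U g.
Proof.
move=> fg Hf p Up; have [cf df] := Hf p Up.
have fg_near : {near p, f =1 g} by exact: near_open fg.
split=> [|i]; last exact: near_eq_derivable (df i).
change (g @ p --> g p); rewrite -(fg p Up); apply: cvg_trans cf.
exact: (@near_eq_cvg _ _ (nbhs p) _ f g fg_near).
Qed.

Lemma partially_derivable_cst (a : R) : partially_derivable U (fun=> a).
Proof. by move=> p _; split; [exact: cst_continuous | move=> i; exact: derivable_cst]. Qed.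

Lemma partially_derivableD f g : partially_derivable U f ->
  partially_derivable U g -> partially_derivable U (fun p => f p + g p).
Proof.
move=> Hf Hg p Up; have [cf df] := Hf p Up; have [cg dg] := Hg p Up.
split=> [|i]; [exact: continuousD | exact: derivableD].
Qed.

Lemma partially_derivableM f g : partially_derivable U f ->
  partially_derivable U g -> partially_derivable U (fun p => f p * g p).
Proof.
move=> Hf Hg p Up; have [cf df] := Hf p Up; have [cg dg] := Hg p Up.
split=> [|i]; [exact: continuousM | exact: derivableM].
Qed.

Lemma partially_derivableV f : (forall p, U p -> f p != 0) ->
  partially_derivable U f -> partially_derivable U (fun p => (f p)^-1).
Proof.
move=> f0 Hf p Up; have [cf df] := Hf p Up.
split=> [|i]; [exact: cvgV (f0 p Up) cf | exact: derivableV (f0 p Up) (df i)].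
Qed.

Lemma eq_Ck k f g : (forall p, U p -> f p = g p) -> Ck k U f -> Ck k U g.
Proof.
elim: k f g => [|k IH] f g fg [Hf Hp].
  by split; first exact: eq_partially_derivable Hf.
split; first exact: eq_partially_derivable Hf.
by move=> i; apply: IH (Hp i) => p Up; exact: (eq_partial i U_open Up fg).
Qed.

Lemma Ck_cst k (a : R) : Ck k U (fun=> a).
Proof.
elim: k a => [|k IH] a; split => //; try exact: partially_derivable_cst.
by move=> i; apply: eq_Ck (IH 0) => p _; rewrite /partial derive_cst.
Qed.

Lemma CkD k f g : Ck k U f -> Ck k U g -> Ck k U (fun p => f p + g p).
Proof.
elim: k f g => [|k IH] f g [Hf Pf] [Hg Pg].
  by split; first exact: partially_derivableD.
split=> [|i]; first exact: partially_derivableD.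
apply: eq_Ck (IH _ _ (Pf i) (Pg i)) => p Up.
exact/esym/(deriveD ((Hf p Up).2 i) ((Hg p Up).2 i)).
Qed.

Lemma CkM k f g : Ck k U f -> Ck k U g -> Ck k U (fun p => f p * g p).
Proof.
elim: k f g => [|k IH] f g Cf Cg; have [Hf Pf] := Cf; have [Hg Pg] := Cg.
  by split; first exact: partially_derivableM.
split=> [|i]; first exact: partially_derivableM.
apply: eq_Ck (CkD (IH _ _ (CkW Cf) (Pg i)) (IH _ _ (CkW Cg) (Pf i))).
by move=> p Up; apply/esym/(deriveM ((Hf p Up).2 i) ((Hg p Up).2 i)).
Qed.

Lemma CkN k f : Ck k U f -> Ck k U (fun p => - f p).
Proof.
move=> Cf; apply: eq_Ck (CkM (Ck_cst k (-1)) Cf) => p _.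
by rewrite mulN1r.
Qed.

(** The derivative - f^-2 f_i contains the inverse of the same f, at one order less, so the
    induction on k runs with f fixed. *)
Lemma CkV k f : (forall p, U p -> f p != 0) -> Ck k U f ->
  Ck k U (fun p => (f p)^-1).
Proof.
move=> f0; elim: k => [|k IH] Cf; have [Hf Pf] := Cf.
  by split; first exact: partially_derivableV.
split=> [|i]; first exact: partially_derivableV.
have CV := IH (CkW Cf).
apply: eq_Ck (CkN (CkM (CkM CV CV) (Pf i))) => p Up.
rewrite /partial deriveV ?f0//; last exact: (Hf p Up).2.
by rewrite -exprVn expr2 -mulNr.
Qed.

Lemma smooth_Ck k f : smooth_on U f -> Ck k U f.
Proof.
elim: k f => [|k IH] f Sf; first by split=> // p Up; exact: (Sf [::] p Up).
split=> [p Up|i]; first exact: (Sf [::] p Up).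
(* An index appended at the end of the multi-index is the first to be differentiated, so [rcons s i]
   for f is [s] for [partial i f]. *)
apply: IH => s p Up; have := Sf (rcons s i) p Up.
by rewrite foldr_rcons.
Qed.

Lemma smooth_entry_Ck {m n} {X : 'rV[R]_2 -> 'M[R]_(m, n)} k a b :
  smooth_on U X -> Ck k U (fun p => X p a b).
Proof.
elim: k X => [|k IH] X SX.
  split=> // p Up; have [cX dX] := SX [::] p Up; split=> [|i].
    apply: (@continuous_comp _ _ _ X (fun M : 'M[R]_(m, n) => M a b)) => //.
    exact: coord_continuous.
  by move/derivable_mxP: (dX i).
split=> [p Up|i].
  have [cX dX] := SX [::] p Up; split=> [|i].
    apply: (@continuous_comp _ _ _ X (fun M : 'M[R]_(m, n) => M a b)) => //.
    exact: coord_continuous.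
  by move/derivable_mxP: (dX i).
have SXi : smooth_on U (partial i X).
  by move=> s p Up; have := SX (rcons s i) p Up; rewrite foldr_rcons.
apply: eq_Ck (IH _ SXi) => p Up.
by rewrite partial_entry//; exact: (SX [::] p Up).2.
Qed.

End OpenDomain.

(** Restricting f to a line makes the one-variable mean value theorem applicable; the two difference
    quotients coincide. *)
Lemma is_derive_line f x v (s : R) : derivable f (s *: v + x) v ->
  is_derive s 1 (fun s => f (s *: v + x)) ('D_v f (s *: v + x)).
Proof.
have quotE : (fun h : R => h^-1 *: (f ((h *: 1 + s) *: v + x) - f (s *: v + x)))
    = (fun h : R => h^-1 *: (f (h *: v + (s *: v + x)) - f (s *: v + x))).
  by apply: funext => h; rewrite [h *: 1]mulr1 scalerDl addrA.
by move=> df; split; rewrite /derivable /derive /= quotE.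
Qed.

(* The second difference is symmetric in i and j, hence partialC. *)
Lemma second_difference {f p} i j {d t : R} :
  let v := delta_mx 0 i : 'rV[R]_2 in let w := delta_mx 0 j : 'rV[R]_2 in
  0 < t -> t * (`|v| + `|w|) < d -> Ck 1 (ball p d) f ->
  exists2 q, ball p d q &
    f (t *: v + (t *: w + p)) - f (t *: v + p) - f (t *: w + p) + f p =
    partial j (partial i f) q * t ^+ 2.
Proof.
move=> v w t0 td [Hf Pf].
(* All points used below stay in the ball on which f is regular. *)
have inb s r : 0 <= s <= t -> 0 <= r <= t -> ball p d (s *: v + (r *: w + p)).
  move=> /andP[s0 st] /andP[r0 rt].
  rewrite -ball_normE /= addrA opprD addrCA subrr addr0 normrN.
  apply: le_lt_trans td; apply: le_trans (ler_normD _ _) _.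
  by rewrite !normrZ mulrDr !ger0_norm// lerD// ler_wpM2r.
have tt : 0 <= t <= t by rewrite ltW /=.
have z0 : 0 <= (0 : R) <= t by rewrite lexx ltW.
have itvW s : s \in `]0, t[ -> 0 <= s <= t.
  by rewrite in_itv /= => /andP[/ltW -> /ltW ->].
(* The second difference is the increment of [phi] over [0, t]. The mean value theorem along [v]
   turns it into an increment of [partial i f] along [w], to which the theorem is applied again. *)
pose phi s := f (s *: v + (t *: w + p)) - f (s *: v + p).
have dphi s : 0 <= s <= t -> is_derive s 1 phi
    (partial i f (s *: v + (t *: w + p)) - partial i f (s *: v + p)).
  move=> st; apply: is_deriveB; apply: is_derive_line.
    by have [_] := Hf _ (inb s t st tt); apply.
  by have := inb s 0 st z0; rewrite scale0r add0r => /Hf[_]; apply.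
have [s sI Es] : exists2 s, s \in `]0, t[ & phi t - phi 0 =
    (partial i f (s *: v + (t *: w + p)) - partial i f (s *: v + p)) * (t - 0).
  apply: (@MVT _ phi (fun s => partial i f (s *: v + (t *: w + p))
                                 - partial i f (s *: v + p)) 0 t t0).
    by move=> s /itvW; exact: dphi.
  apply: derivable_within_continuous => s; rewrite in_itv => /= st.
  exact: (@ex_derive _ _ _ _ _ _ _ (dphi s st)).
have st := itvW _ sI.
pose psi r := partial i f (r *: w + (s *: v + p)).
have dpsi r : 0 <= r <= t ->
    is_derive r 1 psi (partial j (partial i f) (r *: w + (s *: v + p))).
  move=> rt; apply: is_derive_line; rewrite addrCA.
  exact: (((Pf i).1 _ (inb s r st rt)).2 j).
have [r rI Er] : exists2 r, r \in `]0, t[ & psi t - psi 0 =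
    partial j (partial i f) (r *: w + (s *: v + p)) * (t - 0).
  apply: (@MVT _ psi (fun r => partial j (partial i f) (r *: w + (s *: v + p)))
            0 t t0).
    by move=> r /itvW; exact: dpsi.
  apply: derivable_within_continuous => r; rewrite in_itv => /= rt.
  exact: (@ex_derive _ _ _ _ _ _ _ (dpsi r rt)).
exists (r *: w + (s *: v + p)); first by rewrite addrCA; apply: inb => //; exact: itvW.
move: Er Es; rewrite /psi /phi !scale0r !add0r subr0 addrCA => -> Es.
rewrite expr2 mulrA -Es; ring.
Qed.

(** Schwarz's theorem: a single second difference is t^2 times one mixed derivative at a point near
    p and t^2 times the other at a second such point. By continuity both values are within e / 2 of
    those at p. *)
Lemma partialC {U f p} i j : open U -> U p -> Ck 2 U f ->
  partial i (partial j f) p = partial j (partial i f) p.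
Proof.
move=> oU Up Cf.
have cont k l : {for p, continuous (partial k (partial l f))}.
  by case: ((Cf.2 l).2 k) => /(_ p Up)[].
apply/eqP; rewrite -subr_eq0 -normr_le0; apply/ler_addgt0Pl => e e0.
have e20 : 0 < e / 2 by rewrite divr_gt0.
have tri (x y z : R) : `|z - y| < e / 2 -> `|x - y| < e / 2 -> `|x - z| <= e + 0.
  move=> zy xy; rewrite addr0; apply: le_trans (ler_distD y x z) _.
  by rewrite (splitr e) lerD// ltW// distrC.
have near_p : \forall q \near p, [/\ U q,
    `|partial i (partial j f) p - partial i (partial j f) q| < e / 2 &
    `|partial j (partial i f) p - partial j (partial i f) q| < e / 2].
  have /cvgrPdist_lt/(_ _ e20) Hi := cont i j.
  have /cvgrPdist_lt/(_ _ e20) Hj := cont j i.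
  have HU : \forall q \near p, U q by exact: open_nbhs_nbhs.
  apply: (@filterS3 _ (nbhs p) _ _ _ _ _ _ HU Hi Hj) => q Uq hi hj.
  split; [exact: Uq | exact: hi | exact: hj].
have [d /= d0 Hd] := (nbhs_ballP _ _).1 near_p.
pose v := delta_mx 0 i : 'rV[R]_2; pose w := delta_mx 0 j : 'rV[R]_2.
have vw0 : 0 < `|v| + `|w| + 1 by rewrite ltr_wpDl.
(* The summand 1 gives a positive denominator and the strict bound [td]. *)
pose t := d / (`|v| + `|w| + 1).
have t0 : 0 < t by rewrite divr_gt0.
have td : t * (`|v| + `|w|) < d.
  by rewrite -mulrA gtr_pMr// mulrC ltr_pdivrMr// mul1r ltrDl.
have Cb : Ck 1 (ball p d) f by apply: Ck_subset (CkW Cf) => q /Hd[].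
have [q1 /Hd[_ _ Hq1] E1] := @second_difference f p i j d t t0 td Cb.
rewrite [`|v| + _]addrC in td.
have [q2 /Hd[_ Hq2 _] E2] := @second_difference f p j i d t t0 td Cb.
have qE : partial j (partial i f) q1 = partial i (partial j f) q2.
  apply: (@mulIf _ (t ^+ 2)); first by rewrite expf_neq0// gt_eqF.
  apply: (etrans (esym E1)); apply: (etrans _ E2).
  by rewrite [t *: w + (t *: v + p)]addrCA; congr (_ + _); rewrite addrAC.
rewrite qE in Hq1.
exact: (tri _ _ _ Hq1 Hq2).
Qed.

End PartialDerivatives.

(** * From the complex derivative of g to the partial derivatives of Y *)

Section CauchyRiemann.
Set Implicit Arguments.
Unset Strict Implicit.
Context {R : realType}.
Implicit Types (p : 'rV[R]_2) (g : R[i] -> R[i]) (z w : R[i]).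

Lemma normc_le_real w (e : R) : `|w| <= e%:C -> `|complex.Re w| <= e /\ `|complex.Im w| <= e.
Proof.
move=> we; split; rewrite -lecR; apply: le_trans we; first exact: normc_ge_Re.
have <- : `|w * 'i%C| = `|w|.
  by rewrite normrM [`|'i%C|]normc_def /= expr0n expr1n add0r sqrtr1 mulr1.
by apply: le_trans (normc_ge_Re _); rewrite ReiNIm normrN.
Qed.

Lemma complex_quotient_cvg g z (e : R) : derivable (g : R[i]^o -> R[i]^o) z 1 -> 0 < e ->
  exists2 d : R, 0 < d & forall k : R[i], k != 0 -> `|k| < d%:C ->
    `|complex_derive g z - k^-1 * (g (k + z) - g z)| <= e%:C.
Proof.
move=> /cvg_ex[l gl] e0.
have -> : complex_derive g z = l by apply: cvg_lim gl.
have e0' : (0 : R[i]) < e%:C by rewrite ltcR.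
have /cvgrPdist_le/(_ _ e0') := gl.
(* The radius is a priori an element of [R[i]]; positivity in the order of [R[i]] forces its
   imaginary part to vanish. *)
move=> [d /= d0 Hd]; have [dr di] : d = (complex.Re d)%:C /\ 0 < complex.Re d.
  by move: d0; rewrite ltcE /= => /andP[/eqP i0 r0]; case: d Hd i0 r0 => a b /= _ ->.
exists (complex.Re d) => // k k0 kd.
have := Hd k; rewrite /= sub0r normrN -dr in kd *.
by move=> /(_ kd k0); rewrite /GRing.scale /= mulr1.
Qed.

(** The complex difference quotient at the increment [t%:C * w], multiplied by [w], is the real
    quotient in t, and |w| = 1 preserves the error bound. The cases w = 1 and w = i together are the
    Cauchy-Riemann equations. *)
Lemma is_derive_complex g p (v : 'rV[R]_2) w :
  (forall t : R, to_C (t *: v + p) = t%:C * w + to_C p) -> `|w| = 1 ->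
  derivable (g : R[i]^o -> R[i]^o) (to_C p) 1 ->
  is_derive p v (fun q => complex.Re (g (to_C q)))
    (complex.Re (w * complex_derive g (to_C p))) /\
  is_derive p v (fun q => complex.Im (g (to_C q)))
    (complex.Im (w * complex_derive g (to_C p))).
Proof.
move=> line w1 dg; set z := to_C p.
have w0 : w != 0 by rewrite -normr_eq0 w1 oner_eq0.
have key (e : R) : 0 < e -> \forall t \near (0 : R)^',
    `|w * complex_derive g z - (t^-1)%:C * (g (to_C (t *: v + p)) - g z)| <= e%:C.
  move=> e0; have [d d0 Hd] := complex_quotient_cvg dg e0.
  exists d => //= t; rewrite /= sub0r normrN => td t0; rewrite line.
  have k0 : t%:C * w != 0 by rewrite mulf_neq0// -[0]/(0%:C) (inj_eq (@complexI R)).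
  have kd : `|t%:C * w| < d%:C.
    by rewrite normrM w1 mulr1 normc_def /= expr0n addr0 sqrtr_sqr ltcR.
  have := Hd _ k0 kd; rewrite -[X in X <= _ -> _]mul1r -w1 -normrM mulrBr.
  by rewrite mulrA invfM mulrCA mulfV// mulr1 -fmorphV.
have realM (t : R) (y : R[i]) : complex.Re (t%:C * y) = t * complex.Re y /\
    complex.Im (t%:C * y) = t * complex.Im y.
  by case: y => a b /=; split; ring.
have ReB (x y : R[i]) : complex.Re (x - y) = complex.Re x - complex.Re y by case: x y => ? ? [].
have ImB (x y : R[i]) : complex.Im (x - y) = complex.Im x - complex.Im y by case: x y => ? ? [].
have is_deriveP (f : 'rV[R]_2 -> R) (l : R) :
    (forall e : R, 0 < e -> \forall t \near (0 : R)^',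
       `|l - t^-1 * (f (t *: v + p) - f p)| <= e) -> is_derive p v f l.
  move=> Hf; have cf : (fun h => h^-1 *: ((f \o shift p) (h *: v) - f p)) @ 0^' --> l.
    exact/cvgrPdist_le.
  by split; [apply/cvg_ex; exists l | exact: cvg_lim cf].
split; apply: is_deriveP => e /key; apply: filterS => t /normc_le_real[].
  by rewrite ReB (realM _ _).1 ReB.
by rewrite ImB (realM _ _).2 ImB.
Qed.

Lemma T_of_gt0 g p : 0 < T_of g p.
Proof. by rewrite /T_of /normsq; apply: ltr_wpDr => //; rewrite addr_ge0 ?sqr_ge0. Qed.

Lemma dotE3 (x y : 'rV[R]_3) : dot x y = x 0 0 * y 0 0 + x 0 1 * y 0 1 + x 0 2 * y 0 2.
Proof.
rewrite /dot !big_ord_recl big_ord0 addr0 addrA.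
by congr (_ + _ + _); congr (_ * _); congr (_ 0 _); apply: val_inj.
Qed.

(** In this form T enters only through its inverse, which makes the coordinates easy to
    differentiate. *)
Lemma Y_ofE g p : Y_of g p = \row_(j < 3)
  [:: 2 * complex.Re (g (to_C p)) / T_of g p; 2 * complex.Im (g (to_C p)) / T_of g p;
      2 / T_of g p - 1]`_j.
Proof.
have T0 : T_of g p != 0 by rewrite gt_eqF ?T_of_gt0.
apply/rowP => -[[|[|[|//]]] lt3]; rewrite !mxE /=.
- by case: (g _) => a b /=; field.
- by case: (g _) => a b /=; field.
- by field.
Qed.

(** The quotient rule in each coordinate, with [T'] the derivative of |g|^2 along [v]. *)
Lemma is_derive_Y_of g p v (u' v' : R) :
  is_derive p v (fun q => complex.Re (g (to_C q))) u' ->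
  is_derive p v (fun q => complex.Im (g (to_C q))) v' ->
  let a := complex.Re (g (to_C p)) in let b := complex.Im (g (to_C p)) in
  let T := T_of g p in let T' := 2 * (a * u' + b * v') in
  derivable (Y_of g) p v /\
  'D_v (Y_of g) p = \row_(j < 3)
    [:: 2 * u' / T - 2 * a * T' / T ^+ 2; 2 * v' / T - 2 * b * T' / T ^+ 2;
        - 2 * T' / T ^+ 2]`_j.
Proof.
move=> du dv a b T T'.
have T0 q : T_of g q != 0 by rewrite gt_eqF ?T_of_gt0.
have dT : is_derive p v (T_of g) T'.
  have -> : T_of g = cst 1 + ((fun q => complex.Re (g (to_C q))) ^+ 2
                      + (fun q => complex.Im (g (to_C q))) ^+ 2) by [].
  apply: (is_derive_eq (is_deriveD (is_derive_cst _ _ _)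
    (is_deriveD (is_deriveX 2 du) (is_deriveX 2 dv)))).
  by rewrite /T' add0r mulrDr !expr1 !mulrA.
have dV : is_derive p v (fun q => (T_of g q)^-1) (- T' / T ^+ 2).
  split; first by apply: derivableV.
  by rewrite deriveV// derive_val /GRing.scale /= mulNr mulrC -mulNr.
have d0 : is_derive p v (fun q => Y_of g q 0 0) (2 * u' / T - 2 * a * T' / T ^+ 2).
  have -> : (fun q => Y_of g q 0 0) =
      2 *: ((fun q => complex.Re (g (to_C q))) * (fun q => (T_of g q)^-1)).
    by apply/funext => q; rewrite Y_ofE mxE /= -mulrA.
  by apply: is_derive_eq; rewrite /a /T /GRing.scale /=; field.
have d1 : is_derive p v (fun q => Y_of g q 0 1) (2 * v' / T - 2 * b * T' / T ^+ 2).
  have -> : (fun q => Y_of g q 0 1) =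
      2 *: ((fun q => complex.Im (g (to_C q))) * (fun q => (T_of g q)^-1)).
    by apply/funext => q; rewrite Y_ofE mxE /= -mulrA.
  by apply: is_derive_eq; rewrite /b /T /GRing.scale /=; field.
have d2 : is_derive p v (fun q => Y_of g q 0 2) (- 2 * T' / T ^+ 2).
  have -> : (fun q => Y_of g q 0 2) = 2 *: (fun q => (T_of g q)^-1) - cst 1.
    by apply/funext => q; rewrite Y_ofE mxE.
  by apply: is_derive_eq; rewrite /T /GRing.scale /=; field.
have dY : derivable (Y_of g) p v.
  apply/derivable_mxP => i j; rewrite (ord1 i); case: j => -[|[|[|//]]] lt3.
  - by rewrite (_ : Ordinal lt3 = 0) ?(@ex_derive _ _ _ _ _ _ _ d0)//; exact: val_inj.
  - by rewrite (_ : Ordinal lt3 = 1) ?(@ex_derive _ _ _ _ _ _ _ d1)//; exact: val_inj.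
  - by rewrite (_ : Ordinal lt3 = 2) ?(@ex_derive _ _ _ _ _ _ _ d2)//; exact: val_inj.
split=> //; rewrite derive_mx//; apply/rowP => -[[|[|[|//]]] lt3]; rewrite !mxE.
- by rewrite (_ : Ordinal lt3 = 0) ?(@derive_val _ _ _ _ _ _ _ d0)//; exact: val_inj.
- by rewrite (_ : Ordinal lt3 = 1) ?(@derive_val _ _ _ _ _ _ _ d1)//; exact: val_inj.
- by rewrite (_ : Ordinal lt3 = 2) ?(@derive_val _ _ _ _ _ _ _ d2)//; exact: val_inj.
Qed.

(** Y is g followed by the inverse stereographic projection from (0, 0, -1), and both maps are
    conformal. The conformal factor is the inverse of the coefficient in [grad_L]. *)
Lemma partial_Y_of g p : derivable (g : R[i]^o -> R[i]^o) (to_C p) 1 ->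
  [/\ forall i, derivable (Y_of g) p (delta_mx 0 i),
      dot (Y_of g p) (Y_of g p) = 1,
      forall i, dot (Y_of g p) (partial i (Y_of g) p) = 0 &
      forall i j, dot (partial i (Y_of g) p) (partial j (Y_of g) p) =
        (4 * normsq (complex_derive g (to_C p)) / T_of g p ^+ 2) *+ (i == j)].
Proof.
move=> dg; set D := complex_derive g (to_C p).
have T0 : T_of g p != 0 by rewrite gt_eqF ?T_of_gt0.
(* The coordinate directions as complex numbers: the derivative of g along the i-th one is
   [w i * D]. *)
pose w (i : 'I_2) : R[i] := if i == 0 then 1 else 'i%C.
have line (i : 'I_2) (t : R) : to_C (t *: delta_mx 0 i + p) = t%:C * w i + to_C p.
  rewrite /to_C /w !mxE; case: i => -[|[|//]] lt2 /=; apply/eqP; rewrite eq_complex /=.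
    by apply/andP; split; apply/eqP; ring.
  by apply/andP; split; apply/eqP; ring.
have w1 (i : 'I_2) : `|w i| = 1.
  rewrite /w; case: ifP => _; first exact: normr1.
  by rewrite [`|'i%C|]normc_def /= expr0n expr1n add0r sqrtr1.
have dY i := let: conj du dv := is_derive_complex (line i) (w1 i) dg in
  is_derive_Y_of du dv.
have TE : T_of g p = 1 + (complex.Re (g (to_C p)) ^+ 2 + complex.Im (g (to_C p)) ^+ 2) by [].
move: T0 dY; rewrite /partial -/D; case: D => d e; rewrite TE.
case: (g (to_C p)) (Y_ofE g p) TE => a b /= YE TE; rewrite TE in YE * => T0 dY.
split.
- by move=> i; have [] := dY i.
- by rewrite YE dotE3 !mxE /=; field.
- move=> i; have [_ ->] := dY i; rewrite YE dotE3 !mxE /= /w.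
  by case: ifP => _ /=; field.
- move=> i j; have [_ ->] := dY i; have [_ ->] := dY j.
  rewrite dotE3 !mxE /= /normsq /w.
  case: i j => -[|[|//]] li [[|[|//]] lj] /=; rewrite ?mulr1n ?mulr0n; field => //.
Qed.

End CauchyRiemann.

(** * Trace, determinant and characteristic polynomial of 2 by 2 matrices *)

Section TwoByTwo.
Set Implicit Arguments.
Unset Strict Implicit.

Lemma det2 {K : comRingType} (A : 'M[K]_2) : \det A = A 0 0 * A 1 1 - A 0 1 * A 1 0.
Proof.
rewrite (expand_det_row _ 0) !big_ord_recl big_ord0 addr0 /cofactor !det_mx11 !mxE /=.
have -> : lift 0 0 = 1 :> 'I_2 by apply: val_inj.
have -> : lift 1 0 = 0 :> 'I_2 by apply: val_inj.
by rewrite expr0 mul1r expr1 mulN1r mulrN.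
Qed.

Lemma trace2 {K : pzRingType} (A : 'M[K]_2) : \tr A = A 0 0 + A 1 1.
Proof.
rewrite /mxtrace !big_ord_recl big_ord0 addr0.
by congr (_ + A _ _); apply: val_inj.
Qed.

Lemma mulmx2E {K : pzRingType} (A B : 'M[K]_2) i j :
  (A *m B) i j = A i 0 * B 0 j + A i 1 * B 1 j.
Proof.
rewrite mxE !big_ord_recl big_ord0 addr0.
by congr (_ + A _ _ * B _ _); apply: val_inj.
Qed.

Lemma matrix2P {K : Type} (A B : 'M[K]_2) :
  A 0 0 = B 0 0 -> A 0 1 = B 0 1 -> A 1 0 = B 1 0 -> A 1 1 = B 1 1 -> A = B.
Proof.
have ord2 (i : 'I_2) : i = 0 \/ i = 1.
  by case: i => -[|[|//]] lt2; [left|right]; apply: val_inj.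
move=> E00 E01 E10 E11; apply/matrixP => i j.
by case: (ord2 i) => ->; case: (ord2 j) => ->.
Qed.

Lemma adj2 {K : comRingType} (A : 'M[K]_2) : \adj A = (\tr A)%:M - A.
Proof.
have l0 : lift 0 0 = 1 :> 'I_2 by apply: val_inj.
have l1 : lift 1 0 = 0 :> 'I_2 by apply: val_inj.
apply: matrix2P; rewrite trace2 !mxE /cofactor det_mx11 !mxE /= ?l0 ?l1 ?mulr1n ?mulr0n; ring.
Qed.

Lemma trace_invmx2 {K : fieldType} (A : 'M[K]_2) : A \in unitmx ->
  \tr (invmx A) = \tr A / \det A.
Proof.
move=> uA; rewrite /invmx uA adj2 mxtraceZ mulrC linearB /= mxtrace_scalar.
by rewrite mulr2n addrK.
Qed.

Lemma char_poly2 {K : fieldType} (A : 'M[K]_2) (k l : K) :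
  char_poly A = ('X - k%:P) * ('X - l%:P) <-> k + l = \tr A /\ k * l = \det A.
Proof.
have -> : ('X - k%:P) * ('X - l%:P) = 'X^2 - (k + l) *: 'X + (k * l)%:P :> {poly K}.
  by rewrite -mul_polyC polyCD polyCM; ring.
have -> : char_poly A = 'X^2 - (\tr A) *: 'X + (\det A)%:P.
  rewrite /char_poly det2 !mxE /= det2 trace2 -mul_polyC !(polyCD, polyCM, polyCB, polyCN, polyCM).
  by rewrite mulr1n mulr0n; ring.
split=> [/polyP E|[-> ->]//].
have := E 0; have := E 1; rewrite !(coefD, coefN, coefXn, coefZ, coefX, coefC) /=.
by rewrite !mulr0 !mulr1 !oppr0 !add0r !addr0 => /oppr_inj -> ->.
Qed.

(** For symmetric A the discriminant tr^2 - 4 det is the sum of squares [d], so the roots given by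
    the quadratic formula lie in K. *)
Lemma symmetric_char_poly2 {K : rcfType} (A : 'M[K]_2) : A^T = A ->
  exists k l, char_poly A = ('X - k%:P) * ('X - l%:P).
Proof.
move=> /matrixP/(_ 0 1); rewrite mxE => A10.
pose d := (A 0 0 - A 1 1) ^+ 2 + 4 * A 0 1 ^+ 2.
have d0 : 0 <= d by rewrite addr_ge0 ?sqr_ge0// mulr_ge0 ?sqr_ge0 ?ler0n.
exists ((\tr A + Num.sqrt d) / 2), ((\tr A - Num.sqrt d) / 2).
apply/char_poly2; split; first by field.
rewrite mulrACA -invfM [X in X / _]mulrC -subr_sqr sqr_sqrtr// /d trace2 det2 A10.
by field.
Qed.

End TwoByTwo.

(** * Curvatures at a point, from the matrices of the two differentials in a common conformal
    frame *)

Section PointwiseCurvatures.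
Set Implicit Arguments.
Unset Strict Implicit.
Context {R : realType} (X N : 'rV[R]_2 -> 'rV[R]_3) (p : 'rV[R]_2).
Local Notation dX := (differential X p).
Local Notation dN := (differential N p).

(** Turns the immersion hypothesis into invertibility of the square factor of a differential. *)
Lemma row_freeM_unit {m n} (A : 'M[R]_m) (B : 'M[R]_(m, n)) :
  row_free (A *m B) -> A \in unitmx.
Proof.
rewrite -row_free_unit /row_free => /eqP rAB; rewrite eqn_leq rank_leq_row /=.
by rewrite -{1}rAB mxrankM_maxl.
Qed.

(** Here I = W W^T / lam and II = - W^T, so the shape operator is - lam W^-1, and H / K is half the
    trace of its inverse - W / lam. *)
Lemma mean_over_gauss (W : 'M[R]_2) (lam : R) : lam != 0 ->
  dN *m dN^T = lam%:M -> dX = lam^-1 *: (W *m dN) -> row_free dX ->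
  gauss_curvature X N p != 0 /\
  mean_curvature X N p / gauss_curvature X N p = - (\tr W / (2 * lam)).
Proof.
move=> lam0 dNN dXE free; rewrite dXE scalemxAl in free.
have uW : W \in unitmx.
  by have := row_freeM_unit free; rewrite unitmxZ// unitfE invr_eq0.
have IE : fundI X p = lam^-1 *: (W *m W^T).
  rewrite /fundI dXE linearZ /= trmx_mul -scalemxAl -scalemxAr -mulmxA (mulmxA dN) dNN.
  by rewrite mul_scalar_mx -scalemxAr !scalerA mulVf// mulr1.
have IIE : fundII X N p = - W^T.
  rewrite /fundII dXE linearZ /= trmx_mul -scalemxAr mulmxA dNN mul_scalar_mx.
  by rewrite scalerA mulVf// scale1r.
have uI : fundI X p \in unitmx.
  by rewrite IE unitmxZ ?unitmx_mul ?unitmx_tr ?uW// unitfE invr_eq0.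
have AE : shape_operator X N p = - lam *: invmx W.
  rewrite /shape_operator; apply: (canLR (mulmxK uI)).
  rewrite IE IIE -scalemxAl -scalemxAr mulmxA mulVmx// mul1mx scalerA.
  by rewrite mulNr mulfV// scaleN1r.
have detW : \det W != 0 by rewrite -unitfE -unitmxE.
rewrite /gauss_curvature /mean_curvature AE detZ linearZ /= trace_invmx2// det_inv.
split; first by rewrite mulf_neq0 ?invr_eq0// expf_neq0// oppr_eq0.
by field; rewrite lam0.
Qed.

(** Symmetry makes the characteristic polynomial split over R, so [xget] does not fall back on its
    default (0, 0). *)
Lemma principal_curvaturesP : (shape_operator X N p)^T = shape_operator X N p ->
  let: (k, l) := principal_curvatures X N p in
  k + l = \tr (shape_operator X N p) /\ k * l = \det (shape_operator X N p).
Proof.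
move=> /symmetric_char_poly2[k [l kl]].
have := @xgetPex _ (0, 0) [set k : R * R | char_poly (shape_operator X N p) =
                                 ('X - k.1%:P) * ('X - k.2%:P)].
rewrite -/(principal_curvatures X N p); case: (principal_curvatures _ _ _) => k' l'.
by move=> /(_ _)/char_poly2; apply; exists (k, l).
Qed.

(** The factors P = 1 + r b W and Q = 1 - b W are symmetric, commute and satisfy P + r Q = r + 1.
    The shape operator is A = - Q P^-1, whence 1 - r A = (r + 1) P^-1 and 1 + A = b W (1 - r A): the
    spherical curvatures are the eigenvalues of b W. *)
Lemma sphere_congruence_curvatures (W : 'M[R]_2) (E : 'M[R]_(2, 3)) (lam b r : R) :
  lam != 0 -> r + 1 != 0 -> Defs.radius X N p = r -> W^T = W -> E *m E^T = lam%:M ->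
  dX = (1%:M + (r * b) *: W) *m E -> dN = (1%:M - b *: W) *m E -> row_free dX ->
  [/\ sigma_metric X N p = ((r + 1) ^+ 2 * lam)%:M,
      1 - (principal_curvatures X N p).1 * Defs.radius X N p != 0,
      1 - (principal_curvatures X N p).2 * Defs.radius X N p != 0 &
      spherical_mean_curvature X N p = b * \tr W / 2].
Proof.
move=> lam0 r1 rE symW EE dXE dNE free.
pose P := 1%:M + (r * b) *: W; pose Q := 1%:M - b *: W.
have uP : P \in unitmx by apply: (@row_freeM_unit _ _ _ E); rewrite -dXE.
have symP : P^T = P by rewrite /P linearD /= linearZ /= symW trmx1.
have symQ : Q^T = Q by rewrite /Q linearB /= linearZ /= symW trmx1.
have PQ : P *m Q = Q *m P.
  rewrite /P /Q mulmxDl !mulmxBr mulmxBl !mulmxDr !mul1mx !mulmx1.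
  rewrite -!scalemxAl -!scalemxAr !scalerA. generalize (W *m W) => V.
  rewrite [b * (r * b)]mulrC; by apply: matrix2P; rewrite !mxE; ring.
have PrQ : P + r *: Q = (r + 1)%:M.
  by rewrite /P /Q; apply: matrix2P; rewrite !mxE /= ?mulr1n ?mulr0n; ring.
have IE : fundI X p = lam *: (P *m P).
  rewrite /fundI dXE trmx_mul -/P symP -mulmxA (mulmxA E) EE mul_scalar_mx.
  by rewrite -scalemxAr.
have IIE : fundII X N p = - lam *: (Q *m P).
  rewrite /fundII dXE dNE trmx_mul -/P -/Q symP -mulmxA (mulmxA E) EE mul_scalar_mx.
  by rewrite -scalemxAr scaleNr.
have IIIE : fundIII N p = lam *: (Q *m Q).
  rewrite /fundIII dNE trmx_mul -/Q symQ -mulmxA (mulmxA E) EE mul_scalar_mx.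
  by rewrite -scalemxAr.
have uI : fundI X p \in unitmx by rewrite IE unitmxZ ?unitmx_mul ?uP// unitfE.
have AP : shape_operator X N p *m P = - Q.
  have := mulmxKV uI (fundII X N p); rewrite -/(shape_operator X N p) IE IIE.
  rewrite -scalemxAr scaleNr -scalerN => /(scalerI lam0).
  by rewrite mulmxA -mulNmx => /(can_inj (mulmxK uP)).
set A := shape_operator X N p in AP *.
have symA : A^T = A.
  have -> : A = - Q *m invmx P by rewrite -AP mulmxK.
  rewrite trmx_mul linearN /= symQ trmx_inv symP mulmxN mulNmx; congr (- _).
  by apply: (canRL (mulmxK uP)); rewrite -mulmxA -PQ mulmxA mulVmx// mul1mx.
have MP : (1%:M - r *: A) *m P = (r + 1)%:M.
  by rewrite mulmxBl mul1mx -scalemxAl AP scalerN opprK.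
have detM : \det (1%:M - r *: A) != 0.
  have := congr1 determinant MP; rewrite det_mulmx det_scalar => E1.
  apply: contraTneq isT => M0; move: E1; rewrite M0 mul0r => /esym/eqP.
  by rewrite expf_eq0 (negPf r1).
have AM : 1%:M + A = (b *: W) *m (1%:M - r *: A).
  have -> : 1%:M - r *: A = (r + 1) *: invmx P.
    by apply: (can_inj (mulmxK uP)); rewrite MP -scalemxAl mulVmx ?scalemx1.
  rewrite -scalemxAr scalemxAl; apply: (can_inj (mulmxK uP)).
  rewrite mulmxKV// mulmxDl mul1mx AP /P /Q.
  by apply: matrix2P; rewrite !mxE /=; ring.
have := principal_curvaturesP symA; rewrite -/A.
rewrite /spherical_mean_curvature /spherical_curvature rE.
case: (principal_curvatures X N p) => k l /= [trA detA].
clearbody A.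
have detME : \det (1%:M - r *: A) = (1 - k * r) * (1 - l * r).
  transitivity (1 - r * \tr A + r ^+ 2 * \det A); last by rewrite -trA -detA; ring.
  by rewrite !det2 trace2 !mxE /= ?mulr1n ?mulr0n; ring.
(* The right-hand side is the numerator of the sum of the spherical curvatures. It is the trace of
   (1 + A) times the adjugate of 1 - r A, so no diagonalisation is required. *)
have trW : b * \tr W * \det (1%:M - r *: A) = (1 + k) * (1 - l * r) + (1 + l) * (1 - k * r).
  transitivity (\tr ((1%:M + A) *m \adj (1%:M - r *: A))).
    by rewrite AM -mulmxA mul_mx_adj mul_mx_scalar !linearZ /= mulrC; ring.
  transitivity (2 + (1 - r) * \tr A - 2 * r * \det A); last by rewrite -trA -detA; ring.
  rewrite adj2 !trace2 det2 !mulmx2E !mxE /= ?mulr1n ?mulr0n; ring.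
rewrite detME mulf_eq0 negb_or in detM; case/andP: detM => k0 l0.
split=> //.
  rewrite /sigma_metric rE IE IIE IIIE.
  (* With I = lam P^2, II = - lam Q P and III = lam Q^2, the metric sigma is a perfect square
     because P and Q commute. *)
  transitivity (lam *: ((P + r *: Q) *m (P + r *: Q))); last first.
    by rewrite PrQ -scalar_mxM scale_scalar_mx expr2 mulrC.
  clearbody P Q; rewrite mulmxDl !mulmxDr -!scalemxAl -!scalemxAr PQ.
  move: (P *m P) (Q *m P) (Q *m Q) => V1 V2 V3.
  by apply: matrix2P; rewrite !mxE; ring.
rewrite detME in trW; rewrite -(mulfK (mulf_neq0 k0 l0) (b * \tr W)) trW.
by field; rewrite k0 l0.
Qed.

End PointwiseCurvatures.

(** * Inner products, differentiation of vector-valued maps, and the Laplacian of a conformal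
    metric *)

Section VectorCalculus.
Set Implicit Arguments.
Unset Strict Implicit.
Context {R : realType}.
Implicit Types (x y z : 'rV[R]_3) (X Y : 'rV[R]_2 -> 'rV[R]_3) (p : 'rV[R]_2).

Lemma dotC x y : dot x y = dot y x.
Proof. by apply: eq_bigr => k _; rewrite mulrC. Qed.

Lemma dotDl x y z : dot (x + y) z = dot x z + dot y z.
Proof. by rewrite -big_split; apply: eq_bigr => k _; rewrite mxE mulrDl. Qed.

Lemma dotZl a x y : dot (a *: x) y = a * dot x y.
Proof. by rewrite /dot big_distrr; apply: eq_bigr => k _ /=; rewrite mxE mulrA. Qed.

Lemma dotNl x y : dot (- x) y = - dot x y.
Proof. by rewrite -scaleN1r dotZl mulN1r. Qed.

Lemma dotDr x y z : dot z (x + y) = dot z x + dot z y.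
Proof. by rewrite dotC dotDl !(dotC z). Qed.

Lemma dotZr a x y : dot y (a *: x) = a * dot y x.
Proof. by rewrite dotC dotZl (dotC y). Qed.

Lemma dotNr x y : dot y (- x) = - dot y x.
Proof. by rewrite dotC dotNl (dotC y). Qed.

Definition dotE := (dotDl, dotNl, dotZl, dotDr, dotNr, dotZr).

Lemma dot_eq0 x : dot x x = 0 -> x = 0.
Proof.
move=> /eqP; rewrite psumr_eq0 => [/allP x0|k _]; last by rewrite -expr2 sqr_ge0.
apply/rowP => k; rewrite mxE; have := x0 k; rewrite mem_index_enum => /(_ isT).
by rewrite mulf_eq0 orbb => /eqP.
Qed.

Lemma sum2 {V : nmodType} (f : 'I_2 -> V) : \sum_i f i = f 0 + f 1.
Proof.
by rewrite !big_ord_recl big_ord0 addr0; congr (_ + f _); apply: val_inj.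
Qed.

(* The matrices A and B with rows (y, e_0, e_1) and (y, e_0/lam, e_1/lam)
   satisfy A B^T = 1, hence B^T A = 1, which expands z. *)
Lemma frame_expansion y (e : 'I_2 -> 'rV[R]_3) (lam : R) z : lam != 0 ->
  dot y y = 1 -> (forall i, dot y (e i) = 0) ->
  (forall i j, dot (e i) (e j) = lam *+ (i == j)) -> dot z y = 0 ->
  z = lam^-1 *: \sum_i dot z (e i) *: e i.
Proof.
move=> lam0 yy ye ee zy.
pose A : 'M[R]_3 := \matrix_(i < 3) [:: y; e 0; e 1]`_i.
pose B : 'M[R]_3 := \matrix_(i < 3) [:: y; lam^-1 *: e 0; lam^-1 *: e 1]`_i.
have AB : A *m B^T = 1%:M.
  apply/matrixP => i j; rewrite mxE.
  transitivity (dot [:: y; e 0; e 1]`_i [:: y; lam^-1 *: e 0; lam^-1 *: e 1]`_j).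
    by apply: eq_bigr => k _; rewrite !mxE.
  rewrite mxE; case: i j => -[|[|[|//]]] li [[|[|[|//]]] lj] /=;
    by rewrite -?[dot (e _) y]dotC ?dotZr ?yy ?ye ?(dotC _ y) ?ye ?ee ?mulr0 ?mulr1n ?mulVf.
rewrite sum2 -[LHS]mulmx1 -(mulmx1C AB) mulmxA mulmx_sum_row.
rewrite !big_ord_recl big_ord0 addr0 !rowK /=.
have zB k : (z *m B^T) 0 k = dot z [:: y; lam^-1 *: e 0; lam^-1 *: e 1]`_k.
  by rewrite mxE; apply: eq_bigr => l _; rewrite !mxE.
by rewrite !zB /= zy scale0r add0r !dotZr scalerDr !scalerA.
Qed.

Section OpenDomain.
Context {U : set 'rV[R]_2} (U_open : open U).

Definition Ck_vec k X := forall j : 'I_3, Ck k U (fun p => X p 0 j).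

Lemma Ck_vec_derivable k X p i : Ck_vec k X -> U p -> derivable X p (delta_mx 0 i).
Proof.
by move=> CX Up; apply/derivable_mxP => a j; rewrite (ord1 a); exact: Ck_derivable (CX j) Up.
Qed.

Lemma Ck_vec_partial k X i : Ck_vec k.+1 X -> Ck_vec k (partial i X).
Proof.
move=> CX j; apply: (eq_Ck U_open _ ((CX j).2 i)) => p Up.
by rewrite partial_entry//; exact: Ck_vec_derivable CX Up.
Qed.

Lemma Ck_sum k n (F : 'I_n -> 'rV[R]_2 -> R) :
  (forall i, Ck k U (F i)) -> Ck k U (fun p => \sum_i F i p).
Proof.
move=> CF; have -> : (fun p => \sum_i F i p) = \sum_i F i.
  by apply/funext => p; rewrite fct_sumE.
elim/big_rec: _ => [|i f _ Cf]; first exact: (Ck_cst U_open k 0).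
exact: CkD.
Qed.

Lemma Ck_dot k X Y : Ck_vec k X -> Ck_vec k Y -> Ck k U (fun p => dot (X p) (Y p)).
Proof. by move=> CX CY; apply: Ck_sum => j; exact: CkM. Qed.

Lemma Ck_vecD k X Y : Ck_vec k X -> Ck_vec k Y -> Ck_vec k (fun p => X p + Y p).
Proof.
move=> CX CY j; apply: (eq_Ck U_open _ (CkD U_open (CX j) (CY j))) => p _.
by rewrite mxE.
Qed.

Lemma Ck_vecZ k (f : 'rV[R]_2 -> R) X : Ck k U f -> Ck_vec k X -> Ck_vec k (fun p => f p *: X p).
Proof.
move=> Cf CX j; apply: (eq_Ck U_open _ (CkM U_open Cf (CX j))) => p _.
by rewrite mxE.
Qed.

Lemma eq_Ck_vec k X Y : (forall p, U p -> X p = Y p) -> Ck_vec k X -> Ck_vec k Y.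
Proof. by move=> XY CX j; apply: (eq_Ck U_open _ (CX j)) => p Up; rewrite XY. Qed.

Lemma partialM (f g : 'rV[R]_2 -> R) p i : Ck 0 U f -> Ck 0 U g -> U p ->
  partial i (fun q => f q * g q) p = f p * partial i g p + g p * partial i f p.
Proof.
move=> Cf Cg Up.
exact: (deriveM (Ck_derivable (i := i) Cf Up) (Ck_derivable (i := i) Cg Up)).
Qed.

Lemma partialD (V : normedModType R) (f g : 'rV[R]_2 -> V) p i :
  derivable f p (delta_mx 0 i) -> derivable g p (delta_mx 0 i) ->
  partial i (fun q => f q + g q) p = partial i f p + partial i g p.
Proof. exact: deriveD. Qed.

Lemma partial_dot X Y p i : Ck_vec 0 X -> Ck_vec 0 Y -> U p ->
  partial i (fun q => dot (X q) (Y q)) p =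
  dot (partial i X p) (Y p) + dot (X p) (partial i Y p).
Proof.
move=> CX CY Up; have dX := Ck_vec_derivable (i := i) CX Up.
have dY := Ck_vec_derivable (i := i) CY Up.
have -> : (fun q => dot (X q) (Y q)) = \sum_j (fun q => X q 0 j * Y q 0 j).
  by apply/funext => q; rewrite fct_sumE.
rewrite /partial derive_sum => [|j]; last first.
  by apply: derivableM; exact: derivable_entry.
rewrite /dot -big_split; apply: eq_bigr => j _ /=.
rewrite -!/(partial i _ _) !partial_entry// [LHS](partialM _ (CX j) (CY j) Up).
by rewrite addrC; congr (_ + _); rewrite mulrC.
Qed.

Lemma partialZ (f : 'rV[R]_2 -> R) X p i : Ck 0 U f -> Ck_vec 0 X -> U p ->
  partial i (fun q => f q *: X q) p = partial i f p *: X p + f p *: partial i X p.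
Proof.
move=> Cf CX Up; apply/rowP => j.
have -> : partial i (fun q => f q *: X q) p 0 j = partial i (fun q => f q * X q 0 j) p.
  rewrite partial_entry; last exact: Ck_vec_derivable (Ck_vecZ Cf CX) Up.
  by congr (partial i _ p); apply/funext => q; rewrite mxE.
rewrite (partialM _ Cf (CX j) Up) !mxE partial_entry; last exact: Ck_vec_derivable CX Up.
rewrite addrC; congr (_ + _); exact: mulrC.
Qed.

Lemma partialVC X p i j : Ck_vec 2 X -> U p ->
  partial i (partial j X) p = partial j (partial i X) p.
Proof.
move=> CX Up; apply/rowP => k.
have step a b : partial a (partial b X) p 0 k = partial a (partial b (fun q => X q 0 k)) p.
  rewrite partial_entry; last exact: Ck_vec_derivable (Ck_vec_partial b CX) Up.
  apply: (eq_partial a U_open Up) => q Uq.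
  by rewrite partial_entry//; exact: Ck_vec_derivable CX Uq.
apply: etrans (step i j) (etrans _ (esym (step j i))).
exact: (partialC i j U_open Up (CX k)).
Qed.

(** In dimension two the square root of det G cancels the inverse of G, leaving the flat Laplacian
    divided by mu. The regularity comes from [F], so that [f] may be an expression in curvatures
    obtained by choice. *)
Lemma laplacian_conformal G (mu F f : 'rV[R]_2 -> R) (k : R) p : U p ->
  (forall q, U q -> G q = (mu q)%:M) -> (forall q, U q -> 0 < mu q) ->
  (forall q, U q -> f q = k * F q) -> Ck 2 U F ->
  laplacian G f p = k / mu p * \sum_i partial i (partial i F) p.
Proof.
move=> Up GE mu0 fE CF.
have sqrt_det q : U q -> Num.sqrt (\det (G q)) = mu q.
  by move=> Uq; rewrite GE// det_scalar sqrtr_sqr gtr0_norm// mu0.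
have scale_partial (H : 'rV[R]_2 -> R) q i : Ck 0 U H -> U q ->
    partial i (fun q => k * H q) q = k * partial i H q.
  move=> CH Uq; rewrite (partialM i (Ck_cst U_open 0 k) CH Uq).
  by rewrite [partial i (fun=> k) _]derive_cst mulr0 addr0.
have inner i q : U q -> Num.sqrt (\det (G q)) *
    (\sum_(j < 2) invmx (G q) i j * partial j f q) = k * partial i F q.
  move=> Uq; rewrite sqrt_det// GE// invmx_scalar (bigD1 i)//= big1 => [|j ji]; last first.
    by rewrite mxE eq_sym (negPf ji) mul0r.
  rewrite mxE eqxx mulr1n addr0 mulVKf ?gt_eqF ?mu0//.
  rewrite (eq_partial i U_open Uq fE).
  exact: scale_partial (CkW (CkW CF)) Uq.
rewrite /laplacian (sqrt_det p Up) [k / _]mulrC -mulrA; congr (_ * _).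
rewrite big_distrr; apply: eq_bigr => i _.
rewrite (eq_partial i U_open Up (inner i)).
exact: (scale_partial _ _ i (CkW (Ck_partial i CF)) Up).
Qed.

End OpenDomain.
End VectorCalculus.

(** * Pointwise algebra of a frame and of its reflection in the plane orthogonal to [e] *)

Lemma dot_combination {R : realType} (e x y : 'rV[R]_3) (l a b : R) :
  dot e (l *: (a *: x + b *: y)) = l * (a * dot e x + b * dot e y).
Proof. by rewrite !dotE. Qed.

Lemma dot_combination0 {R : realType} (x : 'rV[R]_3) (f : 'I_2 -> 'rV[R]_3) (w : 'I_2 -> R) :
  (forall j, dot x (f j) = 0) -> dot x (\sum_j w j *: f j) = 0.
Proof. by move=> xf; rewrite sum2 !dotE !xf !mulr0 addr0. Qed.

Section FrameAlgebra.
Set Implicit Arguments.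
Unset Strict Implicit.
Context {R : realType} {y e : 'rV[R]_3} {f : 'I_2 -> 'rV[R]_3} {d : 'I_2 -> R}.
Context {a lam : R}.
Hypothesis yy : dot y y = 1.
Hypothesis yf : forall i, dot y (f i) = 0.
Hypothesis ff : forall i j, dot (f i) (f j) = lam *+ (i == j).

(** In the application [y], [f], [e], [d], [a] are Y, its partial derivatives, eta, the partial
    derivatives of h, and h. Pairing with the orthogonal frame reads off the coefficients. *)
Lemma dot_gradient : lam != 0 -> e = lam^-1 *: (\sum_i d i *: f i) + a *: y ->
  dot e y = a /\ forall i, dot e (f i) = d i.
Proof.
move=> lam0 ->; have fy i : dot (f i) y = 0 by rewrite dotC.
rewrite sum2; split=> [|i]; first by rewrite !dotE !fy yy; ring.
rewrite !dotE !ff yf; case: i => -[|[|//]] l; rewrite /= ?mulr1n ?mulr0n.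
  by rewrite (_ : Ordinal l = 0); [field | exact: val_inj].
by rewrite (_ : Ordinal l = 1); [field | exact: val_inj].
Qed.

Hypothesis ey : dot e y = a.
Hypothesis ef : forall i, dot e (f i) = d i.
Hypothesis e0 : dot e e != 0.

(** The parameters c and 0 correspond to X and N, so one formula covers the products <X, X>, <X, N>
    and <N, N>. *)
Lemma dot_reflections (s t : R) :
  dot (y - (2 * (a + s) / dot e e) *: e) (y - (2 * (a + t) / dot e e) *: e) =
  1 + (2 * (a + s) * t + 2 * (a + t) * s) / dot e e.
Proof.
have ye : dot y e = a by rewrite dotC.
by rewrite !dotE yy ey ye; move: (dot e e) e0 => S S0; field.
Qed.

(** Since d_i = <e, f_i>, these vectors are the reflections of the f_i, and a reflection preserves
    inner products. *)
Lemma dot_reflected_frame i j :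
  dot (f i - (2 * d i / dot e e) *: e) (f j - (2 * d j / dot e e) *: e) =
  lam *+ (i == j).
Proof.
have fe k : dot (f k) e = d k by rewrite dotC.
by rewrite !dotE ff !ef !fe; move: (dot e e) e0 => S S0; field.
Qed.

(** As a = <e, y>, the first vector is the image of [y] under the same reflection. *)
Lemma dot_reflected_normal i :
  dot (y - (2 * a / dot e e) *: e) (f i - (2 * d i / dot e e) *: e) = 0.
Proof.
have ye : dot y e = a by rewrite dotC.
by rewrite !dotE yf !ef ye; move: (dot e e) e0 => S S0; field.
Qed.

(* The left-hand side is the i-th derivative of y - (2 (a + t) / S) e when
   e_i = lam^-1 (w_0 f_0 + w_1 f_1) and S = <e, e>. *)
Lemma reflected_derivative (w : 'I_2 -> R) (t : R) i (S : R) :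
  lam != 0 -> S != 0 ->
  f i + (- 2 * (a + t) * (- (2 * (lam^-1 * (w 0 * d 0 + w 1 * d 1))) / S ^+ 2)
         + S^-1 * (- 2 * d i)) *: e
      + (- 2 * (a + t) / S) *: (lam^-1 *: (w 0 *: f 0 + w 1 *: f 1)) =
  \sum_j ((i == j)%:R - 2 * (a + t) / (S * lam) * w j) *:
     (f j - (2 * d j / S) *: e).
Proof.
move=> lam0 S0; rewrite sum2.
have [->|->] : i = 0 \/ i = 1 by case: i => -[|[|//]] l; [left|right]; exact: val_inj.
all: move: (f 0) (f 1) (d 0) (d 1) (w 0) (w 1) => f0 f1 d0 d1 w0 w1.
all: apply/rowP => k; rewrite !mxE /=; move: (f0 0 k) (f1 0 k) (e 0 k) => x0 x1 z.
all: by field; rewrite S0.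
Qed.

End FrameAlgebra.

(** * The surfaces eta and X: differentials, curvatures and the reduction to a flat Laplace
    equation *)

Section Geometry.
Set Implicit Arguments.
Unset Strict Implicit.
Context {R : realType} {U : set 'rV[R]_2} {g : R[i] -> R[i]} {h : 'rV[R]_2 -> R}.
Hypothesis U_open : open U.
Hypothesis g_hol : holomorphic_on g U.
Hypothesis g'_neq0 : forall p, U p -> complex_derive g (to_C p) != 0.
Hypothesis h_neq0 : forall p, U p -> h p != 0.
Local Notation Y := (Y_of g).
Local Notation eta := (eta_of g h).
Local Notation S := (S_of g h).

(** Expressed through the map itself and not through g', so that its regularity follows from that of
    Y. *)
Definition conformal_factor (Z : 'rV[R]_2 -> 'rV[R]_3) p : R :=
  dot (partial 0 Z p) (partial 0 Z p).
Local Notation lam := (conformal_factor Y).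

Lemma Y_frame p : U p ->
  [/\ dot (Y p) (Y p) = 1, forall i, dot (Y p) (partial i Y p) = 0,
      forall i j, dot (partial i Y p) (partial j Y p) = lam p *+ (i == j) &
      0 < lam p /\ T_of g p ^+ 2 / (4 * normsq (complex_derive g (to_C p))) = (lam p)^-1].
Proof.
move=> Up; have [_ YY YYi YiYj] := partial_Y_of (g_hol Up).
have lamE : lam p = 4 * normsq (complex_derive g (to_C p)) / T_of g p ^+ 2.
  by rewrite /conformal_factor YiYj.
have n0 : 0 < normsq (complex_derive g (to_C p)).
  rewrite lt_neqAle /normsq addr_ge0 ?sqr_ge0// andbT eq_sym.
  rewrite paddr_eq0 ?sqr_ge0// !sqrf_eq0.
  by have := g'_neq0 Up; case: (complex_derive _ _) => a b; rewrite eq_complex.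
split=> //; first by move=> i j; rewrite lamE YiYj.
by rewrite lamE invf_div; split=> //; rewrite !(divr_gt0, mulr_gt0, exprn_gt0, T_of_gt0).
Qed.

Lemma etaE p : U p ->
  eta p = (lam p)^-1 *: \sum_(i < 2) partial i h p *: partial i Y p + h p *: Y p.
Proof. by move=> Up; have [_ _ _ [_ <-]] := Y_frame Up. Qed.

Lemma eta_Y p : U p ->
  dot (eta p) (Y p) = h p /\ forall i, dot (eta p) (partial i Y p) = partial i h p.
Proof.
move=> Up; have [YY YYi YiYj [lam0 _]] := Y_frame Up.
exact: (dot_gradient YY YYi YiYj (lt0r_neq0 lam0) (etaE Up)).
Qed.

(** The product <eta, Y> = h does not vanish, hence neither does eta. *)
Lemma S_neq0 p : U p -> S p != 0.
Proof.
move=> Up; apply: contra (h_neq0 Up) => /eqP/dot_eq0 e0.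
by have [<- _] := eta_Y Up; rewrite e0 -[0](scale0r (Y p)) dotZl mul0r.
Qed.

(** Lets every formula for [X_of g h t] serve for both X and N. *)
Lemma N_ofE : N_of g h = X_of g h 0.
Proof. by apply/funext => p; rewrite /X_of addr0. Qed.

Lemma dot_X_of p s t : U p ->
  dot (X_of g h s p) (X_of g h t p) =
  1 + (2 * (h p + s) * t + 2 * (h p + t) * s) / S p.
Proof.
move=> Up; have [YY _ _ _] := Y_frame Up; have [eY _] := eta_Y Up.
exact: (dot_reflections YY eY (S_neq0 Up)).
Qed.

Section Smooth.
Hypothesis h_Ck : forall k, Ck k U h.
Hypothesis Y_Ck : forall k, @Ck_vec _ U k Y.
Hypothesis eta_Ck : forall k, @Ck_vec _ U k eta.

Definition W_of p : 'M[R]_2 := \matrix_(i, j) dot (partial i eta p) (partial j Y p).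

(** Differentiating <eta, Y> = h and cancelling <eta, Y_i> = h_i shows that Y is normal to eta. *)
Lemma partial_eta_Y p i : U p -> dot (partial i eta p) (Y p) = 0.
Proof.
move=> Up; have := partial_dot i (eta_Ck 0) (Y_Ck 0) Up.
rewrite (eq_partial i U_open Up (fun q Uq => (eta_Y Uq).1)).
by rewrite (eta_Y Up).2 => /eqP; rewrite -subr_eq subrr => /eqP.
Qed.

(** Differentiating <eta, Y_j> = h_j gives W_ij = h_ij - <eta, Y_ij>, and both terms on the right
    are symmetric. *)
Lemma W_of_sym p : U p -> (W_of p)^T = W_of p.
Proof.
move=> Up; apply/matrixP => i j; rewrite !mxE.
have hess a b : partial a (partial b h) p =
    dot (partial a eta p) (partial b Y p) + dot (eta p) (partial a (partial b Y) p).
  rewrite -(partial_dot a (eta_Ck 0) (Ck_vec_partial U_open b (Y_Ck 1)) Up).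
  by rewrite (eq_partial a U_open Up (fun q Uq => (eta_Y Uq).2 b)).
have := hess i j; rewrite (partialC i j U_open Up (h_Ck 2)) hess.
by rewrite (partialVC U_open i j (Y_Ck 2) Up) => /addIr.
Qed.

Lemma partial_eta p i : U p ->
  partial i eta p = (lam p)^-1 *: \sum_j W_of p i j *: partial j Y p.
Proof.
move=> Up; have [YY YYi YiYj [lam0 _]] := Y_frame Up.
rewrite [LHS](frame_expansion (lt0r_neq0 lam0) YY YYi YiYj); last exact: partial_eta_Y.
by congr (_ *: _); apply: eq_bigr => j _; rewrite mxE.
Qed.

Lemma differential_mul (Z : 'rV[R]_2 -> 'rV[R]_3) (A : 'M[R]_2) (f : 'I_2 -> 'rV[R]_3) p :
  (forall i, partial i Z p = \sum_j A i j *: f j) ->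
  differential Z p = A *m \matrix_j f j.
Proof.
move=> ZE; apply/row_matrixP => i; rewrite rowK ZE row_mul mulmx_sum_row.
by apply: eq_bigr => j _; rewrite rowK mxE.
Qed.

Lemma mul_tr_dot n (f k : 'I_n -> 'rV[R]_3) :
  (\matrix_i f i) *m (\matrix_i k i)^T = \matrix_(i, j) dot (f i) (k j).
Proof. by apply/matrixP => i j; rewrite !mxE; apply: eq_bigr => l _; rewrite !mxE. Qed.

Lemma differential_eta p : U p ->
  differential eta p = (lam p)^-1 *: (W_of p *m differential Y p).
Proof.
move=> Up; rewrite (scalemxAl _ (W_of p)); apply: differential_mul => i.
rewrite (partial_eta i Up) scaler_sumr; apply: eq_bigr => j _.
by rewrite scalerA; congr (_ *: _); rewrite [RHS]mxE.
Qed.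

Lemma fundIII_Y p : U p -> fundIII Y p = (lam p)%:M.
Proof.
move=> Up; have [_ _ YiYj _] := Y_frame Up.
by rewrite /fundIII mul_tr_dot; apply/matrixP => i j; rewrite !mxE YiYj.
Qed.

(* The image of [partial i Y p] under the reflection in the plane orthogonal to [eta p]. *)
Definition reflected_frame p i : 'rV[R]_3 :=
  partial i Y p - (2 * partial i h p / S p) *: eta p.

Lemma reflected_frameP p : U p ->
  (forall i, dot (N_of g h p) (reflected_frame p i) = 0) /\
  (forall i j, dot (reflected_frame p i) (reflected_frame p j) = lam p *+ (i == j)).
Proof.
move=> Up; have S0 := S_neq0 Up; have [YY YYi YiYj _] := Y_frame Up.
have [eY eYi] := eta_Y Up; split=> [i|i j].
  exact: (dot_reflected_normal YYi eY eYi S0).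
exact: (dot_reflected_frame YiYj eYi S0).
Qed.

Lemma partial_S p i : U p -> partial i S p = 2 * dot (eta p) (partial i eta p).
Proof.
move=> Up; rewrite (partial_dot i (eta_Ck 0) (eta_Ck 0) Up).
by rewrite dotC mulrDl mul1r.
Qed.

Lemma S_Ck k : Ck k U S.
Proof. exact: (Ck_dot U_open (eta_Ck k) (eta_Ck k)). Qed.

(** The product rule yields Y_i, eta and eta_i; since eta_i lies in the span of the Y_j,
    [reflected_derivative] regroups everything in the reflected frame. The values t = c and t = 0
    give dX and dN. *)
Lemma partial_X p t i : U p ->
  partial i (X_of g h t) p =
  \sum_j (1%:M - (2 * (h p + t) / (S p * lam p)) *: W_of p) i j *: reflected_frame p j.
Proof.
move=> Up; have S0 := S_neq0 Up.
have [YY YYi YiYj [lam0 _]] := Y_frame Up; have [eY eYi] := eta_Y Up.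
have CV := CkV U_open S_neq0 (S_Ck 0).
have Cht : Ck 0 U (fun q => -2 * (h q + t)).
  by apply: (CkM U_open (Ck_cst U_open 0 _)); exact: (CkD U_open (h_Ck 0) (Ck_cst U_open 0 t)).
have XE q : X_of g h t q = Y q + (-2 * (h q + t) * (S q)^-1) *: eta q.
  by rewrite /X_of -scaleNr; congr (_ + _ *: _); rewrite !mulNr.
have -> : X_of g h t = fun q => Y q + (-2 * (h q + t) * (S q)^-1) *: eta q.
  exact/funext.
rewrite partialD; last 2 first.
- exact: Ck_vec_derivable (Y_Ck 0) Up.
- exact: Ck_vec_derivable (Ck_vecZ U_open (CkM U_open Cht CV) (eta_Ck 0)) Up.
rewrite (partialZ U_open i (CkM U_open Cht CV) (eta_Ck 0) Up) (partialM i Cht CV Up).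
have -> : partial i (fun q => -2 * (h q + t)) p = -2 * partial i h p.
  rewrite (partialM i (Ck_cst U_open 0 _) (CkD U_open (h_Ck 0) (Ck_cst U_open 0 t)) Up).
  rewrite partialD; last 2 first.
  - exact: Ck_derivable (h_Ck 0) Up.
  - exact: Ck_derivable (Ck_cst U_open 0 t) Up.
  by rewrite !{2}/partial !derive_cst addr0 mulr0 addr0.
have -> : partial i (fun q => (S q)^-1) p = - partial i S p / S p ^+ 2.
  rewrite /partial deriveV//; last exact: Ck_derivable (S_Ck 0) Up.
  by rewrite /GRing.scale /= mulNr mulrC mulNr.
have Se : dot (eta p) (partial i eta p) =
    (lam p)^-1 * (W_of p i 0 * partial 0 h p + W_of p i 1 * partial 1 h p).
  by rewrite (partial_eta i Up) sum2 -(eYi 0) -(eYi 1); exact: dot_combination.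
rewrite (partial_S i Up) Se (partial_eta i Up) sum2.
apply: etrans (eq_bigr _ _); first rewrite addrA; first exact:
  (reflected_derivative (f := fun j => partial j Y p) (d := fun j => partial j h p)
     (W_of p i) t i (lt0r_neq0 lam0) S0).
by move=> j _; rewrite !mxE.
Qed.

(** As h is the support function of eta, this is the Laplacian of h for L plus 2 h, that is, minus
    the sum of the principal radii of curvature of eta. *)
Definition support_trace p : R := \tr (W_of p) / lam p.

Lemma support_trace_Ck k : Ck k U support_trace.
Proof.
have Clam : Ck k U lam.
  by apply: (Ck_dot U_open); exact: (Ck_vec_partial U_open 0 (Y_Ck k.+1)).
have CW i : Ck k U (fun p => W_of p i i).
  apply: (eq_Ck U_open _ (Ck_dot U_open (Ck_vec_partial U_open i (eta_Ck k.+1))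
                                        (Ck_vec_partial U_open i (Y_Ck k.+1)))).
  by move=> p _; rewrite mxE.
apply: (eq_Ck U_open _ (CkM U_open (CkD U_open (CW 0) (CW 1)) (CkV U_open _ Clam))).
  by move=> p _; rewrite /support_trace trace2.
by move=> p Up; have [_ _ _ [lam0 _]] := Y_frame Up; rewrite gt_eqF.
Qed.

(** III of eta is lam times the flat metric and H / K is -1/2 times [support_trace], so the two
    Laplacians differ by a nonzero factor. The conditions on the normal and on K hold
    automatically. *)
Lemma Laguerre_minimalP : immersion_on U eta ->
  Laguerre_minimal eta Y U <->
  forall p, U p -> \sum_i partial i (partial i support_trace) p = 0.
Proof.
move=> eta_imm.
have curv p (Up : U p) : gauss_curvature eta Y p != 0 /\
    mean_curvature eta Y p / gauss_curvature eta Y p = - 2^-1 * support_trace p.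
  have [_ _ _ [lam0 _]] := Y_frame Up; have lam_neq0 := lt0r_neq0 lam0.
  have [K0 ->] := mean_over_gauss lam_neq0 (fundIII_Y Up) (differential_eta Up)
                    (eta_imm.2 p Up).
  split; first exact: K0.
  rewrite /support_trace; move: (\tr _) (lam p) lam_neq0 => tr l l0.
  by field.
have lapE p (Up : U p) : laplacian (fundIII Y)
    (fun q => mean_curvature eta Y q / gauss_curvature eta Y q) p =
    - 2^-1 / lam p * \sum_i partial i (partial i support_trace) p.
  apply: (laplacian_conformal U_open Up fundIII_Y) => [q Uq|q Uq|].
  - by have [_ _ _ []] := Y_frame Uq.
  - exact: (curv q Uq).2.
  - exact: support_trace_Ck.
have factor0 p : U p -> - 2^-1 / lam p != 0.
  move=> Up; have [_ _ _ [lam0 _]] := Y_frame Up.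
  by rewrite mulf_neq0 ?invr_eq0 ?oppr_eq0 ?invr_eq0 ?pnatr_eq0 ?gt_eqF.
split=> [[_ _ _ lap0] p Up|lap0].
  by apply: (mulfI (factor0 p Up)); rewrite -lapE// mulr0 lap0.
split=> // p Up; last by rewrite lapE// lap0// mulr0.
  have [YY _ _ _] := Y_frame Up; split=> // i.
  by rewrite dotC partial_eta_Y.
by have [] := curv p Up.
Qed.

Lemma differential_X p t : U p -> differential (X_of g h t) p =
  (1%:M - (2 * (h p + t) / (S p * lam p)) *: W_of p) *m \matrix_j reflected_frame p j.
Proof. by move=> Up; apply: differential_mul => i; exact: partial_X. Qed.

(** The metric sigma is conformally flat, and H_S / (Psi - 1) is [support_trace] divided by 2 c; the
    remaining conditions in [H2_surface] follow from the pointwise formulas. *)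
Lemma H2_surfaceP c : c != 0 -> immersion_on U (X_of g h c) ->
  H2_surface (X_of g h c) (N_of g h) U <->
  forall p, U p -> \sum_i partial i (partial i support_trace) p = 0.
Proof.
move=> c0 X_imm; pose X := X_of g h c; pose N := N_of g h.
(* The radius function: the quotient of 1 - |X|^2 = - 4 c (h + c) / S by 2 (Psi - 1) = 4 c h / S. *)
pose r p := - (h p + c) / h p.
have PsiE p : U p -> Psi X N p - 1 = 2 * h p * c / S p.
  move=> Up; rewrite /Psi /N N_ofE dot_X_of// !addr0 mulr0 add0r.
  by rewrite addrC addKr.
have Psi0 p : U p -> Psi X N p - 1 != 0.
  by move=> Up; rewrite PsiE// !mulf_neq0 ?invr_eq0 ?pnatr_eq0 ?h_neq0 ?S_neq0.
have radiusE p : U p -> Defs.radius X N p = r p.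
  move=> Up; have S0 := S_neq0 Up; have h0 := h_neq0 Up.
  rewrite /Defs.radius PsiE// dot_X_of// /r; field.
  by rewrite c0 h0 S0.
have curv p (Up : U p) : [/\ sigma_metric X N p = ((r p + 1) ^+ 2 * lam p)%:M,
      1 - (principal_curvatures X N p).1 * Defs.radius X N p != 0,
      1 - (principal_curvatures X N p).2 * Defs.radius X N p != 0 &
      spherical_mean_curvature X N p =
        2 * h p / (S p * lam p) * \tr (W_of p) / 2].
  have S0 := S_neq0 Up; have h0 := h_neq0 Up.
  have [_ _ _ [lam0 _]] := Y_frame Up; have lam_neq0 := lt0r_neq0 lam0.
  (* Applied with b = 2 h / (S lam), for which r b = - 2 (h + c) / (S lam) is the coefficient of W
     in dX. Here r + 1 = - c / h is nonzero because c is. *)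
  apply: (sphere_congruence_curvatures lam_neq0 _ (radiusE p Up) (W_of_sym Up)
            (E := \matrix_j reflected_frame p j)).
  - rewrite /r (_ : _ + 1 = - c / h p) ?mulf_neq0 ?oppr_eq0 ?invr_eq0//.
    by field.
  - rewrite mul_tr_dot; apply/matrixP => i j.
    by rewrite mxE (reflected_frameP Up).2 mxE.
  - rewrite differential_X//; congr (_ *m _); rewrite -scaleNr; congr (_ + _ *: _).
    by rewrite /r; field; rewrite lam_neq0 S0.
  - by rewrite /N N_ofE differential_X// addr0.
  - exact: X_imm.2.
have r1 p : U p -> 0 < (r p + 1) ^+ 2.
  move=> Up; have h0 := h_neq0 Up; rewrite exprn_even_gt0//= /r.
  rewrite (_ : _ + 1 = - c / h p) ?mulf_neq0 ?oppr_eq0 ?invr_eq0//.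
  by field.
have mu0 p : U p -> 0 < (r p + 1) ^+ 2 * lam p.
  by move=> Up; have [_ _ _ [lam0 _]] := Y_frame Up; rewrite mulr_gt0// r1.
have lapE p (Up : U p) : laplacian (sigma_metric X N)
    (fun q => spherical_mean_curvature X N q / (Psi X N q - 1)) p =
    (2 * c)^-1 / ((r p + 1) ^+ 2 * lam p) * \sum_i partial i (partial i support_trace) p.
  apply: (laplacian_conformal U_open Up _ mu0) => [q Uq|q Uq|].
  - by have [] := curv q Uq.
  - have S0 := S_neq0 Uq; have h0 := h_neq0 Uq; have [_ _ _ [lam0 _]] := Y_frame Uq.
    have [_ _ _ ->] := curv q Uq; rewrite PsiE// /support_trace.
    move: (\tr _) (lam q) lam0 => tr l l0.
    by field; rewrite S0 h0 c0 gt_eqF.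
  - exact: support_trace_Ck.
have factor0 p : U p -> (2 * c)^-1 / ((r p + 1) ^+ 2 * lam p) != 0.
  by move=> Up; rewrite mulf_neq0 ?invr_eq0 ?(lt0r_neq0 (mu0 p Up)) ?mulf_neq0 ?pnatr_eq0.
split=> [[_ _ _ _ lap0] p Up|lap0].
  by apply: (mulfI (factor0 p Up)); rewrite -lapE// mulr0 lap0.
split=> // p Up.
- split=> [|i].
    by rewrite /N N_ofE dot_X_of// !addr0 !mulr0 addr0 mul0r addr0.
  have [Nf _] := reflected_frameP Up.
  by rewrite (partial_X c i Up); exact: dot_combination0 Nf.
- by rewrite -subr_eq0; exact: Psi0.
- by have [] := curv p Up.
- by rewrite lapE// lap0// mulr0.
Qed.

End Smooth.

(** The definition of X is solved for Y, and S does not vanish. *)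
Lemma Y_of_Ck c k : (forall k, Ck k U h) -> (forall k, @Ck_vec _ U k eta) ->
  (forall k, @Ck_vec _ U k (X_of g h c)) -> @Ck_vec _ U k Y.
Proof.
move=> h_Ck eta_Ck X_Ck.
have CS := Ck_dot U_open (eta_Ck k) (eta_Ck k).
have Ccoef : Ck k U (fun p => 2 * (h p + c) * (S p)^-1).
  apply: (CkM U_open _ (CkV U_open S_neq0 CS)).
  exact: (CkM U_open (Ck_cst U_open k _) (CkD U_open (h_Ck k) (Ck_cst U_open k c))).
apply: (eq_Ck_vec U_open _ (Ck_vecD U_open (X_Ck k) (Ck_vecZ U_open Ccoef (eta_Ck k)))).
by move=> p _; rewrite /X_of subrK.
Qed.

End Geometry.

Theorem proposition3p7 (R : realType) (U : set 'rV[R]_2) (g : R[i] -> R[i])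
    (c : R) (h : 'rV[R]_2 -> R)
    (U_open : open U)
    (g_hol : holomorphic_on g U)
    (g'_neq0 : forall p, U p -> complex_derive g (to_C p) != 0)
    (c_neq0 : c != 0)
    (h_smooth : smooth_on U h)
    (h_neq0 : forall p, U p -> h p != 0)
    (X_imm : immersion_on U (X_of g h c))
    (eta_imm : immersion_on U (eta_of g h)) :
  H2_surface (X_of g h c) (N_of g h) U <->
  Laguerre_minimal (eta_of g h) (Y_of g) U.
Proof.
have h_Ck k : Ck k U h by exact: smooth_Ck.
have eta_Ck k : @Ck_vec _ U k (eta_of g h).
  by move=> j; exact: (smooth_entry_Ck U_open k 0 j eta_imm.1).
have X_Ck k : @Ck_vec _ U k (X_of g h c).
  by move=> j; exact: (smooth_entry_Ck U_open k 0 j X_imm.1).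
have Y_Ck k := Y_of_Ck U_open g_hol g'_neq0 h_neq0 k h_Ck eta_Ck X_Ck.
(* The two conditions meet in the flat harmonicity of [support_trace]. *)
apply: iff_trans (H2_surfaceP U_open g_hol g'_neq0 h_neq0 h_Ck Y_Ck eta_Ck c_neq0 X_imm) _.
exact: (iff_sym (Laguerre_minimalP U_open g_hol g'_neq0 Y_Ck eta_Ck eta_imm)).
Qed.
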